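(* Let $m$ be an $n$-variable monomial of degree $k$. Then $N_k(m)=\{U\in\mathcal{U}_{n,k}:\ \mathrm{rank}(G_U[\mathrm{Var}(m)])=k\}$.
   Context: $\mathcal{U}_{n,k}$ is the set of $k$-dimensional linear subspaces of $\mathbb{F}_2^n$. For $U\in\mathcal{U}_{n,k}$, $G_U$ is the unique $k\times n$ matrix over $\mathbb{F}_2$ of rank $k$ in reduced row echelon form whose rows span $U$. For $I\subseteq[n]$, $G_U[I]$ is the submatrix of $G_U$ formed by the columns indexed by $I$. For a monomial $m=\prod_{i\in I}x_i$, $\mathrm{Var}(m)=I$. $N_k(m)$ is the set of $U\in\mathcal{U}_{n,k}$ with $\sum_{x\in U}m(x)\neq 0$ (in $\mathbb{F}_2$). Ranks are over $\mathbb{F}_2$. *)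

(* Defs.v *)
From mathcomp Require Import all_boot all_order all_algebra.
From mathcomp Require Import mpoly.

Set Implicit Arguments.
Unset Strict Implicit.
Unset Printing Implicit Defensive.

Import GRing.Theory.
Local Open Scope ring_scope.

Definition leading (F : finFieldType) (k n : nat) (G : 'M[F]_(k, n))
    (i : 'I_k) (j : 'I_n) : bool :=
  (G i j != 0) && [forall j' : 'I_n, (j' < j)%N ==> (G i j' == 0)].

(* Zero rows come last, leading entries move strictly to the right, and the
   column of a leading entry is a unit vector. *)
Definition is_rref (F : finFieldType) (k n : nat) (G : 'M[F]_(k, n)) : bool :=
  [&& [forall i : 'I_k, forall i' : 'I_k,
         (i < i')%N && (row i G == 0) ==> (row i' G == 0)],
      [forall i : 'I_k, forall i' : 'I_k, forall j : 'I_n, forall j' : 'I_n,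
         [&& (i < i')%N, leading G i j & leading G i' j'] ==> (j < j')%N]
    & [forall i : 'I_k, forall j : 'I_n,
         leading G i j ==> (col j G == delta_mx i 0)]].

Definition row_span (F : finFieldType) (k n : nat) (G : 'M[F]_(k, n)) :
    {vspace 'rV[F]_n} :=
  <<[seq row i G | i : 'I_k]>>%VS.

Definition is_rref_of (F : finFieldType) (n : nat) (U : {vspace 'rV[F]_n})
    (G : 'M[F]_(\dim U, n)) : bool :=
  [&& is_rref G, \rank G == \dim U & row_span G == U].

Arguments is_rref_of {F n} U G.

Section RrefTheory.
Variables (F : finFieldType).

Lemma leadingP k n (G : 'M[F]_(k, n)) i j :
  reflect (G i j != 0 /\ forall j' : 'I_n, (j' < j)%N -> G i j' = 0)
          (leading G i j).
Proof.
apply: (iffP andP) => -[-> H]; split=> //.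
  by move=> j' lt; apply/eqP; exact: (implyP (forallP H j')).
by apply/forallP=> j'; apply/implyP=> /H ->.
Qed.

Lemma is_rrefP k n (G : 'M[F]_(k, n)) :
  reflect [/\ forall i i' : 'I_k, (i < i')%N -> row i G = 0 -> row i' G = 0,
              forall (i i' : 'I_k) (j j' : 'I_n), (i < i')%N ->
                leading G i j -> leading G i' j' -> (j < j')%N
            & forall (i : 'I_k) (j : 'I_n), leading G i j ->
                col j G = delta_mx i 0]
          (is_rref G).
Proof.
apply: (iffP and3P) => -[H1 H2 H3]; split.
- move=> i i' lt /eqP r0; apply/eqP.
  by apply: (implyP (forallP (forallP H1 i) i')); rewrite lt.
- move=> i i' j j' lt l l'.
  apply: (implyP (forallP (forallP (forallP (forallP H2 i) i') j) j')).
  by rewrite lt l.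
- by move=> i j l; apply/eqP; exact: (implyP (forallP (forallP H3 i) j)).
- apply/forallP=> i; apply/forallP=> i'; apply/implyP=> /andP[lt /eqP r0].
  by apply/eqP; exact: H1 r0.
- apply/forallP=> i; apply/forallP=> i'; apply/forallP=> j; apply/forallP=> j'.
  by apply/implyP=> /and3P[lt l l']; exact: H2 l l'.
- by apply/forallP=> i; apply/forallP=> j; apply/implyP=> /H3 ->.
Qed.

Lemma leading_inj k n (G : 'M[F]_(k, n)) i j j' :
  leading G i j -> leading G i j' -> j = j'.
Proof.
move=> /leadingP[nz H] /leadingP[nz' H']; apply: val_inj.
case: (ltngtP j j') => // lt; first by rewrite H' ?eqxx in nz.
by rewrite H ?eqxx in nz'.
Qed.

Lemma leading_row k n (G : 'M[F]_(k, n)) i j :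
  leading (row i G) 0 j = leading G i j.
Proof.
by rewrite /leading mxE; congr (_ && _); apply: eq_forallb => j'; rewrite mxE.
Qed.

Lemma leading_ex k n (G : 'M[F]_(k, n)) i :
  row i G != 0 -> exists j, leading G i j.
Proof.
move=> nz; have [j0 nz0] : exists j, G i j != 0.
  apply/existsP; apply: contraR nz => /existsPn H; apply/eqP/rowP=> j.
  by rewrite !mxE; apply/eqP; move: (H j); rewrite negbK.
case: (@arg_minnP _ j0 (fun j => G i j != 0) val nz0) => j nzj min.
exists j; apply/leadingP; split=> // j' lt; apply/eqP; apply: contraTT lt.
by rewrite -leqNgt; exact: min.
Qed.

Lemma rv_min p (u : 'rV[F]_p) :
  u != 0 -> exists a, u 0 a != 0 /\ forall b : 'I_p, (b < a)%N -> u 0 b = 0.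
Proof.
move=> nz; have [|a /leadingP H] := @leading_ex _ _ u 0; last by exists a.
by rewrite row_id.
Qed.

Lemma mem_row_span k n (G : 'M[F]_(k, n)) (u : 'rV[F]_n) :
  (u \in row_span G) = (u <= G)%MS.
Proof.
apply/idP/submxP => [|[c ->]].
  move=> uG; rewrite (coord_span uG).
  apply: (big_ind (fun w : 'rV[F]_n => exists D, w = D *m G)).
  - by exists 0; rewrite mul0mx.
  - by move=> _ _ [D1 ->] [D2 ->]; exists (D1 + D2); rewrite mulmxDl.
  move=> i _; set w := _`_i; have /imageP[l _ ->] : w \in [seq row i G | i : 'I_k].
    by rewrite mem_nth ?size_image.
  by rewrite rowE scalemxAl; eexists.
rewrite mulmx_sum_row; apply: memv_suml => i _; apply: memvZ.
by apply: memv_span; apply/imageP; exists i.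
Qed.

Lemma enum_val_lt n (P : {set 'I_n}) (a b : 'I_#|P|) :
  (a < b)%N -> (enum_val a < enum_val b)%N.
Proof.
have srt : sorted ltn (map val (enum P)).
  apply: (subseq_sorted ltn_trans (s2 := map val (enum 'I_n))).
    by apply: map_subseq; rewrite [enum 'I_n]enumT; exact: filter_subseq.
  by rewrite val_enum_ord iota_ltn_sorted.
move=> lt; set x0 := enum_default a.
have e (c : 'I_#|P|) : val (enum_val c) = nth 0%N (map val (enum P)) c.
  by rewrite (nth_map x0) ?(enum_val_nth x0) // -cardE.
rewrite /= !e; apply: (sorted_ltn_nth ltn_trans) => //.
- by rewrite inE size_map -cardE.
- by rewrite inE size_map -cardE.
Qed.

Lemma echelon_lead k n (V : 'M[F]_(k, n)) (g : 'I_k -> 'I_n) (u : 'rV[F]_k) :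
  (forall a b : 'I_k, (a < b)%N -> (g a < g b)%N) ->
  (forall a, leading V a (g a)) -> u != 0 ->
  exists a, leading (u *m V) 0 (g a).
Proof.
move=> inc lead /rv_min[a [nza min]]; exists a.
have tail (b : 'I_k) (j : 'I_n) : (j < g a)%N || (j == g a) && (b != a) ->
    u 0 b * V b j = 0.
  move=> H; case: (ltngtP b a) => [lt|lt|/val_inj eba].
  - by rewrite min ?mul0r.
  - have /leadingP[_ ->] := lead b; rewrite ?mulr0 //.
    apply: leq_ltn_trans (inc _ _ lt).
    by case/orP: H => [/ltnW //|/andP[/eqP -> _]].
  - move: H; rewrite eba eqxx andbF orbF => lt.
    by have /leadingP[_ ->] := lead a; rewrite ?mulr0.
apply/leadingP; split.
  rewrite mxE (bigD1 a) //= big1 ?addr0 => [|b nb].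
    by rewrite mulf_neq0 //; case/leadingP: (lead a).
  by apply: tail; rewrite eqxx nb orbT.
by move=> j lt; rewrite mxE big1 // => b _; apply: tail; rewrite lt.
Qed.

Lemma rref_mx_exists k n (B : 'M[F]_(k, n)) :
  row_free B -> exists2 M : 'M[F]_k, M \in unitmx & is_rref (M *m B).
Proof.
move=> freeB.
pose P := [set j | [exists v : 'rV[F]_n, (v <= B)%MS && leading v 0 j]].
have leadP (v : 'rV[F]_n) j : (v <= B)%MS -> leading v 0 j -> j \in P.
  by move=> vB vj; rewrite inE; apply/existsP; exists v; rewrite vB.
have P0 (v : 'rV[F]_n) : (v <= B)%MS -> (forall j, j \in P -> v 0 j = 0) ->
    v = 0.
  move=> vB v0; apply/eqP; apply: contraT => nz.
  have [|j vj] := @leading_ex _ _ v 0; first by rewrite row_id.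
  by case/leadingP: (vj) => /eqP[]; apply: v0; exact: leadP vj.
have free_of q m (A : 'M[F]_(q, m)) :
    (forall u : 'rV_q, u *m A = 0 -> u = 0) -> row_free A.
  move=> H; rewrite -kermx_eq0; apply/eqP/row_matrixP=> i.
  by rewrite row0; apply: H; rewrite -row_mul mulmx_ker row0.
have colP m (f : 'I_m -> 'I_n) : (forall j, j \in P -> exists a, f a = j) ->
    row_free (colsub f B).
  move=> fP; apply: free_of => u u0; apply/(row_free_inj freeB).
  rewrite /= mul0mx; apply: P0 => [|j /fP[a <-]]; first exact: submxMl.
  have /rowP/(_ a) := u0; rewrite !mxE => u0a; rewrite -[RHS]u0a.
  by apply: eq_bigr => i _; rewrite mxE.
have enumP j : j \in P -> exists a : 'I_#|P|, enum_val a = j.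
  by move=> jP; exists (enum_rank_in jP j); rewrite enum_rankK_in.
have le1 : (k <= #|P|)%N.
  have := colP _ _ enumP; rewrite /row_free => /eqP <-; exact: rank_leq_col.
have ePk : #|P| = k.
  apply/eqP; rewrite eqn_leq le1 andbT.
  have w (a : 'I_#|P|) : {v : 'rV[F]_n | (v <= B)%MS & leading v 0 (enum_val a)}.
    have: [exists v : 'rV[F]_n, (v <= B)%MS && leading v 0 (enum_val a)].
      by have := enum_valP a; rewrite inE.
    by move=> /existsP/sigW[v /andP[]]; exists v.
  pose V := \matrix_a s2val (w a).
  have VB : (V <= B)%MS by apply/row_subP=> a; rewrite rowK; case: (w a).
  have lV a : leading V a (enum_val a).
    by rewrite -leading_row rowK; case: (w a).
  have /eqP <- : row_free V.
    apply: free_of => u u0; apply/eqP; apply: contraT => nz.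
    have [a] := echelon_lead (@enum_val_lt _ P) lV nz.
    by rewrite u0 => /leadingP[]; rewrite mxE eqxx.
  by apply: leq_trans (mxrankS VB) _; exact: rank_leq_row.
pose f (i : 'I_k) : 'I_n := enum_val (cast_ord (esym ePk) i).
have fP j : j \in P -> exists i, f i = j.
  move=> /enumP[a <-]; exists (cast_ord ePk a); rewrite /f; congr enum_val.
  exact: val_inj.
have finc (a b : 'I_k) : (a < b)%N -> (f a < f b)%N.
  by move=> lt; apply: enum_val_lt.
have unitC : colsub f B \in unitmx by rewrite -row_free_unit; exact: colP.
set C := colsub f B in unitC.
exists (invmx C); first by rewrite unitmx_inv.
set G := invmx C *m B.
have G1 : colsub f G = 1%:M.
  rewrite -(mulVmx unitC); apply/matrixP=> i j; rewrite !mxE.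
  by apply: eq_bigr => l _; rewrite !mxE.
have Gf i j : G i (f j) = (i == j)%:R.
  by have /matrixP/(_ i j) := G1; rewrite !mxE.
have lG i j : leading G i j -> j = f i.
  move=> lij; have : j \in P.
    apply: (leadP (row i G)); first by rewrite row_mul submxMl.
    by rewrite leading_row.
  move=> /fP[i' ei']; case/leadingP: lij; rewrite -ei' Gf.
  by case: (i =P i') => [->|_]; rewrite ?eqxx.
apply/is_rrefP; split=> [i i' _ /rowP/(_ (f i))|i i' j j' lt /lG -> /lG ->|i j /lG ->].
- rewrite [LHS]mxE [RHS]mxE Gf eqxx => /eqP.
  by rewrite oner_eq0.
- exact: finc.
- by apply/matrixP=> l o; rewrite ord1 [LHS]mxE [RHS]mxE Gf andbT.
Qed.

Lemma rref_lead k n (G : 'M[F]_(k, n)) :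
  is_rref G -> row_free G ->
  exists g : 'I_k -> 'I_n,
    [/\ forall a b : 'I_k, (a < b)%N -> (g a < g b)%N,
        forall a, leading G a (g a) & colsub g G = 1%:M].
Proof.
move=> /is_rrefP[_ inc cols] freeG.
have ex i : exists j, leading G i j.
  apply: leading_ex; apply/eqP=> r0.
  have : delta_mx 0 i = 0 :> 'rV[F]_k.
    by apply/(row_free_inj freeG); rewrite /= -rowE r0 mul0mx.
  by move=> /rowP/(_ i)/eqP; rewrite !mxE !eqxx oner_eq0.
exists (fun i => xchoose (ex i)).
have lead i := xchooseP (ex i); split=> //.
  by move=> a b lt; exact: (inc a b).
apply/matrixP=> i j; rewrite !mxE.
by have /colP/(_ i) := cols _ _ (lead j); rewrite !mxE andbT.
Qed.

Lemma rref_mx_uniq k n (G G' : 'M[F]_(k, n)) :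
  is_rref G -> is_rref G' -> row_free G -> row_free G' ->
  (G == G')%MS -> G = G'.
Proof.
move=> rG rG' fG fG' /andP[GG' G'G].
have [g [inc lead id_g]] := rref_lead rG fG.
have [g' [inc' lead' id_g']] := rref_lead rG' fG'.
have sub m (A A' : 'M[F]_(m, n)) (h h' : 'I_m -> 'I_n) :
    (forall a b : 'I_m, (a < b)%N -> (h a < h b)%N) ->
    (forall a, leading A a (h a)) -> (forall a, leading A' a (h' a)) ->
    (A' <= A)%MS -> {subset codom h' <= codom h}.
  move=> hi hl hl' le j /codomP[a ->].
  have lr : leading (row a A') 0 (h' a) by rewrite leading_row.
  have /submxP[u eu] : (row a A' <= A)%MS by apply: submx_trans le; exact: row_sub.
  have nzu : u != 0.
    by apply: contraTneq lr => u0; rewrite eu u0 mul0mx; apply/negP=> /leadingP[]; rewrite mxE eqxx.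
  have [b] := echelon_lead hi hl nzu; rewrite -eu => /(leading_inj lr) ->.
  exact: codom_f.
have srt (h : 'I_k -> 'I_n) : (forall a b : 'I_k, (a < b)%N -> (h a < h b)%N) ->
    sorted (fun x y : 'I_n => (x < y)%N) (codom h).
  move=> hi; rewrite /codom /image_mem.
  apply: (homo_sorted (e := fun x y : 'I_k => (x < y)%N)) => //.
  have := iota_ltn_sorted 0 k; rewrite -val_enum_ord sorted_map.
  by [].
have egg : g =1 g'.
  have : codom g = codom g'.
    apply: (@irr_sorted_eq _ (fun x y : 'I_n => (x < y)%N)).
    - by move=> x y z; exact: ltn_trans.
    - by move=> x; exact: ltnn.
    - exact: srt.
    - exact: srt.
    - by move=> j; apply/idP/idP; [exact: (sub _ G' G)|exact: (sub _ G G')].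
  by move=> /eq_in_map H a; apply: H; rewrite mem_enum.
have /submxP[M eM] := GG'.
suff M1 : M = 1%:M by rewrite eM M1 mul1mx.
have : colsub g G = M *m colsub g G'.
  by rewrite {1}eM; apply/matrixP=> i j; rewrite !mxE;
    apply: eq_bigr => l _; rewrite !mxE.
have -> : colsub g G' = colsub g' G' by apply/matrixP=> i j; rewrite !mxE egg.
by rewrite id_g id_g' mulmx1 => ->.
Qed.

Lemma rref_exists n (U : {vspace 'rV[F]_n}) :
  exists G : 'M[F]_(\dim U, n), is_rref_of U G.
Proof.
pose B : 'M[F]_(\dim U, n) := \matrix_i (vbasis U)`_i.
have spB : row_span B = U.
  rewrite /row_span -[RHS](span_basis (vbasisP U)).
  apply: eq_span => v; apply/imageP/idP => [[i _ ->]|vU].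
    by rewrite rowK mem_nth ?size_tuple.
  have lt : (index v (vbasis U) < \dim U)%N.
    by rewrite -[X in (_ < X)%N](size_tuple (vbasis U)) index_mem.
  by exists (Ordinal lt); rewrite // rowK nth_index.
have freeB : row_free B.
  rewrite -kermx_eq0; apply/eqP/row_matrixP=> i; rewrite row0.
  set u := row i _; have : u *m B = 0 by rewrite -row_mul mulmx_ker row0.
  rewrite mulmx_sum_row => u0; apply/rowP=> a; rewrite [RHS]mxE.
  have /freeP := basis_free (vbasisP U); apply.
  by rewrite -[RHS]u0; apply: eq_bigr => b _; rewrite rowK.
have [M uM rM] := rref_mx_exists freeB; exists (M *m B); apply/and3P; split=> //.
  by apply/eqP; rewrite mxrankMfree // mxrank_unit.
rewrite -[eqbRHS]spB; apply/eqP/vspaceP=> u; rewrite !mem_row_span.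
by rewrite (eqmxMfull B) // row_full_unit.
Qed.

Lemma rref_uniq n (U : {vspace 'rV[F]_n}) (G G' : 'M[F]_(\dim U, n)) :
  is_rref_of U G -> is_rref_of U G' -> G = G'.
Proof.
move=> /and3P[rG kG /eqP sG] /and3P[rG' kG' /eqP sG'].
apply: rref_mx_uniq; rewrite /row_free //.
have eGG' : row_span G = row_span G' by rewrite sG sG'.
apply/andP; split; apply/row_subP=> i; rewrite -mem_row_span.
  by rewrite -eGG' mem_row_span row_sub.
by rewrite eGG' mem_row_span row_sub.
Qed.

End RrefTheory.

Definition rref_basis (F : finFieldType) (n : nat) (U : {vspace 'rV[F]_n}) :
    'M[F]_(\dim U, n) :=
  xchoose (rref_exists U).

Lemma rref_basisP (F : finFieldType) (n : nat) (U : {vspace 'rV[F]_n})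
    (G : 'M[F]_(\dim U, n)) :
  is_rref_of U G <-> G = rref_basis U.
Proof.
have rU : is_rref_of U (rref_basis U) by exact: xchooseP.
by split=> [rG|->//]; exact: rref_uniq rG rU.
Qed.

Definition subspaces (n k : nat) : {pred {vspace 'rV['F_2]_n}} :=
  [pred U | \dim U == k].
Arguments subspaces n k : clear implicits.

Definition col_restrict (R : Type) (k n : nat) (G : 'M[R]_(k, n))
    (I : {set 'I_n}) : 'M[R]_(k, #|I|) :=
  colsub (fun j : 'I_#|I| => enum_val j) G.

(* Monomials of Boolean functions are the products of distinct variables, so
   a monomial is represented by its exponent vector with entries at most 1. *)
Definition squarefree (n : nat) (m : 'X_{1..n}) : Prop :=
  forall i, (m i <= 1)%N.

Definition Var (n : nat) (m : 'X_{1..n}) : {set 'I_n} :=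
  [set i | m i != 0%N].

Definition N_ (n k : nat) (m : 'X_{1..n}) : {pred {vspace 'rV['F_2]_n}} :=
  [pred U in subspaces n k |
     \sum_(x : 'rV['F_2]_n | x \in U) ('X_[m] : {mpoly 'F_2[n]}).@[x 0] != 0].
Arguments N_ {n} k m.

(* Main.v *)
Require Import Defs.
From mathcomp Require Import all_boot all_order all_algebra.
From mathcomp Require Import mpoly.

(** Parametrising U by u |-> u *m G_U, the sum of m over U counts, modulo 2,
the solutions u of u *m G_U[Var m] = (1, ..., 1).  These form an empty set or a
coset of the left kernel of G_U[Var m], so their number is odd exactly when
the kernel is trivial and a solution exists; the latter is automatic for an
invertible square matrix. *)

Import GRing.Theory.
Local Open Scope ring_scope.

Lemma F2_neq0 (x : 'F_2) : (x != 0) = (x == 1).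
Proof. by case: x => [[|[|]]]. Qed.

(** Choose [i] with [w 0 i = 1]: translation by [w] exchanges the vectors whose [i]-th coordinate is
    0 with those where it is 1, so each value occurs twice and cancels in characteristic 2. *)
Lemma sum_F2_translate_eq0 k (f : 'rV['F_2]_k -> 'F_2) (w : 'rV['F_2]_k) :
  w != 0 -> (forall u, f (u + w) = f u) -> \sum_u f u = 0.
Proof.
move=> /rV0Pn[i wi] fw; have {}wi : w 0 i = 1 by apply/eqP; rewrite -F2_neq0.
rewrite (bigID (fun u : 'rV_k => u 0 i == 0)) /=.
rewrite [X in _ + X](reindex (+%R^~ w)) /=; last first.
  by exists (+%R^~ (- w)) => u _; rewrite ?addrK ?subrK.
rewrite (eq_bigr _ (fun u _ => fw u)).
rewrite [X in _ + X](eq_bigl (fun u : 'rV_k => u 0 i == 0)) => [|u]; last first.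
  by rewrite mxE wi; case: (u 0 i) => [[|[|]]].
by rewrite -mulr2n -mulr_natr [2%:R](_ : _ = 0) ?mulr0 //; apply/val_inj.
Qed.

Lemma sum_F2_solutions k l (A : 'M['F_2]_(k, l)) (b : 'rV['F_2]_l) :
  \sum_(u : 'rV_k) (u *m A == b)%:R = (row_free A && (b <= A)%MS)%:R :> 'F_2.
Proof.
have [freeA|] := boolP (row_free A); last first.
  rewrite -kermx_eq0 => /rowV0Pn[w /sub_kermxP wA0 w0].
  (* Adding the nonzero kernel vector [w] preserves the equation, so solutions come in pairs. *)
  by apply: (sum_F2_translate_eq0 _ _ w w0) => u; rewrite mulmxDl wA0 addr0.
have [/submxP[v ->]|bA] := boolP (b <= A)%MS; last first.
  rewrite big1 // => u _; case: eqP => // uAb.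
  by rewrite -uAb submxMl in bA.
rewrite (bigD1 v) //= eqxx big1 ?addr0 // => u.
by rewrite (inj_eq (row_free_inj freeA)) => /negbTE ->.
Qed.

(** Row freeness makes [u |-> u *m G] injective; [pinvmx G] inverts it on the row span. *)
Lemma sum_row_span (R : nmodType) (F : finFieldType) k n (G : 'M[F]_(k, n))
    (f : 'rV[F]_n -> R) :
  row_free G -> \sum_(x | x \in row_span G) f x = \sum_(u : 'rV_k) f (u *m G).
Proof.
move=> freeG; rewrite (reindex_onto (mulmx^~ G) (mulmx^~ (pinvmx G))) /=.
  by apply: eq_bigl => u; rewrite mem_row_span submxMl mulmxKp ?eqxx.
by move=> x; rewrite mem_row_span => /mulmxKpV.
Qed.

(** Over ['F_2] each factor with positive exponent is 0 or 1, so the product is the indicator that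
    all of them are 1. *)
Lemma mevalX_F2 n (m : 'X_{1..n}) (v : 'I_n -> 'F_2) :
  ('X_[m] : {mpoly 'F_2[n]}).@[v] = [forall i in Var m, v i == 1]%:R.
Proof.
rewrite mevalX.
case: (boolP [forall i in _, _]) => [/forall_inP v1|].
  rewrite big1 // => i _; have := v1 i; rewrite inE.
  case: (m i) => [_|e /(_ isT)/eqP ->]; first by rewrite expr0.
  by rewrite expr1n.
rewrite negb_forall_in => /exists_inP[i]; rewrite inE -F2_neq0 negbK.
by move=> mi /eqP vi; rewrite (bigD1 i) //= vi expr0n (negbTE mi) mul0r.
Qed.

Lemma card_Var n (m : 'X_{1..n}) : squarefree m -> #|Var m| = mdeg m.
Proof.
move=> m_sf; rewrite mdegE -sum1_card big_mkcond /=; apply: eq_bigr => i _.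
by rewrite inE; case: (m i) (m_sf i) => [|[|]].
Qed.

Lemma mul_col_restrict (R : pzRingType) p k n (u : 'M[R]_(p, k))
    (G : 'M[R]_(k, n)) (I : {set 'I_n}) :
  u *m col_restrict G I = col_restrict (u *m G) I.
Proof.
by apply/matrixP=> i j; rewrite !mxE; apply: eq_bigr => l _; rewrite mxE.
Qed.

Lemma col_restrict_eq1 (R : nzRingType) n (x : 'rV[R]_n) (I : {set 'I_n}) :
  (col_restrict x I == const_mx 1) = [forall i in I, x 0 i == 1].
Proof.
apply/eqP/forall_inP => [/rowP x1 i iI|x1].
  by have := x1 (enum_rank_in iI i); rewrite !mxE enum_rankK_in // => ->.
by apply/rowP=> j; rewrite !mxE; apply/eqP/x1/enum_valP.
Qed.

Theorem theorem4p3 (n k : nat) (m : 'X_{1..n}) (m_sf : squarefree m)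
    (deg_m : mdeg m = k) :
  N_ k m =i
  [pred U in subspaces n k |
     \rank (col_restrict (rref_basis U) (Var m)) == k].
Proof.
move=> U; rewrite !inE; have [dimU|//] := eqVneq (\dim U) k.
have /and3P[_ freeG /eqP spanG] : is_rref_of U (rref_basis U).
  exact/rref_basisP.
(* Only the left side is rewritten, so that [rref_basis U] on the right stays intact. *)
rewrite -[in X in X = _]spanG sum_row_span //=.
under eq_bigr do
  rewrite mevalX_F2 -col_restrict_eq1 -mul_col_restrict.
rewrite sum_F2_solutions -[in RHS]dimU -/(row_free _).
have [freeA|_] := boolP (row_free _); last by rewrite eqxx.
(* Since [#|Var m| = k = \dim U], the submatrix is square: independent rows give full column rank,
   so the all-ones vector lies in its row space. *)
suff fullA : row_full (col_restrict (rref_basis U) (Var m)).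
  by rewrite submx_full ?oner_eq0.
by apply/eqP; rewrite (eqP freeA) card_Var // deg_m.
Qed.
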